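(* Let $R$ be an integral domain with finite quotients, i.e. $R/(b)$ is finite for every $b\in R\setminus\{0\}$. For any family $\mathcal F$ of nonzero ideals of $R$, the natural homomorphism $\mathfrak A[R]\to\mathfrak A_{\mathcal F}[R]$ sending generators to generators ($u^a\mapsto u^a$, $s_b\mapsto s_b$) exists and is an isomorphism.
   Context: An integral domain is a commutative unital ring ($1\ne0$) without zero-divisors other than $0$; $R^\times=R\setminus\{0\}$ here, and $(b)=bR$. For an integral domain $R$ with finite quotients, $\mathfrak A[R]$ denotes here the universal C*-algebra generated by unitaries $\{u^a: a\in R\}$ and isometries $\{s_b:b\in R^\times\}$ subject to: $u^0=1=s_1$; $u^as_bu^cs_d=u^{a+bc}s_{bd}$ for all $a,c\in R$, $b,d\in R^\times$; and $\sum_{a+(b)\in R/(b)}u^as_bs_b^*u^{-a}=1$ for all $b\in R^\times$ (the summands depend only on the coset $a+(b)$). An algebra over $R$ is a family $\mathcal C$ of subsets of $R$ containing $R$ and closed under finite unions, finite intersections and complements; it is called $P_R$-invariant if $a + bX \in \mathcal C$ for all $X\in\mathcal C$, $a\in R$, $b\in R^\times$. $\mathcal C(\mathcal F)$ is the smallest $P_R$-invariant algebra over $R$ containing $\mathcal F$. $\mathfrak A_{\mathcal F}[R]$ is the universal C*-algebra generated by projections $\{e_{[X]} : X\in\mathcal C(\mathcal F)\}$, unitaries $\{u^a : a\in R\}$ and isometries $\{s_b : b\in R^\times\}$ subject to: $u^0=1=s_1$; $u^a s_b u^c s_d = u^{a+bc}s_{bd}$; $u^a s_b e_{[X]} s_b^*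 (u^a)^* = e_{[a+bX]}$; $e_{[R]}=1$; $e_{[X]}e_{[Y]}=e_{[X\cap Y]}$; $e_{[X\cup Y]}=e_{[X]}+e_{[Y]}$ if $X\cap Y=\emptyset$. *)

(* Defs.v *)
From HB Require Import structures.
From mathcomp Require Import all_boot all_order all_algebra.
From mathcomp Require Import all_classical all_reals all_analysis.
From mathcomp Require Import complex.
Set Implicit Arguments.
Unset Strict Implicit.
Unset Printing Implicit Defensive.
Import Order.TTheory GRing.Theory Num.Theory.
Import numFieldNormedType.Exports.
Local Open Scope classical_set_scope.
Local Open Scope complex_scope.
Local Open Scope ring_scope.

(* Unital C*-algebras over the complex numbers K[i], with 1 != 0 as built into
   algType (the zero algebra adds nothing to the universal properties below).  The norm is part
   of the mixin because the hierarchies of normed modules and of rings have no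
   join below Num.NumDomain. *)
HB.mixin Record isCStarAlgebra (K : realType) (A : Type)
    & GRing.Algebra K[i] A := {
  star : A -> A;
  cnorm : A -> K;
  starK : forall x : A, star (star x) = x;
  starD : forall x y : A, star (x + y) = star x + star y;
  starZ : forall (c : K[i]) (x : A), star (c *: x) = Num.conj c *: star x;
  starM : forall x y : A, star (x * y) = star y * star x;
  cnorm_ge0 : forall x : A, 0 <= cnorm x;
  cnorm_eq0 : forall x : A, cnorm x = 0 -> x = 0;
  cnormD : forall x y : A, cnorm (x + y) <= cnorm x + cnorm y;
  cnormZ : forall (c : K[i]) (x : A), (cnorm (c *: x))%:C = `|c| * (cnorm x)%:C;
  cnormM : forall x y : A, cnorm (x * y) <= cnorm x * cnorm y;
  cstar_id : forall x : A, cnorm (star x * x) = cnorm x ^+ 2;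
  cnorm_complete : forall x : nat -> A,
    (forall eps : K, 0 < eps -> exists N : nat, forall m n : nat,
       (N <= m)%N -> (N <= n)%N -> cnorm (x m - x n) < eps) ->
    exists l : A, (fun n => cnorm (x n - l)) @ \oo --> (0 : K)
}.

#[short(type="cstarAlgType")]
HB.structure Definition CStarAlgebra (K : realType) :=
  {A of GRing.Algebra K[i] A & isCStarAlgebra K A}.

Section CStarElements.
Context (K : realType) (A : cstarAlgType K).

Definition is_projection (p : A) := star p = p /\ p * p = p.

Definition is_unitary (v : A) := star v * v = 1 /\ v * star v = 1.

Definition is_isometry (v : A) := star v * v = 1.

End CStarElements.

Definition star_preserving (K : realType) (A B : cstarAlgType K)
  (f : A -> B) := forall x, f (star x) = star (f x).

Section IntegralDomain.
Context (R : idomainType).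

Definition affine_image (a b : R) (X : set R) : set R :=
  [set a + b * x | x in X].

Definition coset (a b : R) : set R := affine_image a b setT.

Definition cosets (b : R) : set (set R) := range (coset^~ b).

Definition finite_quotients := forall b : R, b != 0 -> finite_set (cosets b).

Definition is_ideal (I : set R) :=
  [/\ I 0, forall x y, I x -> I y -> I (x + y)
    & forall r x, I x -> I (r * x)].

Definition is_nonzero_ideal (I : set R) := is_ideal I /\ I != [set 0].

Definition invariant_algebra (C : set (set R)) :=
  [/\ C setT, setU_closed C, setI_closed C, setC_closed C
    & forall (X : set R) (a b : R), C X -> b != 0 -> C (affine_image a b X)].

Definition generated_algebra (F : set (set R)) : set (set R) :=
  smallest invariant_algebra F.

End IntegralDomain.

(* The generators are given by total functions u, s, e on R, R and the subsets
   of R; the values s 0, and e X for X outside generated_algebra F, are never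
   constrained nor used. *)
Section Representations.
Context (K : realType) (R : idomainType).

(* [xget 0 c] is a chosen element of the (nonempty) coset c. *)
Record ring_rep (A : cstarAlgType K) (u s : R -> A) : Prop := RingRep {
  ring_rep_unitary : forall a, is_unitary (u a);
  ring_rep_isometry : forall b, b != 0 -> is_isometry (s b);
  ring_rep_u0 : u 0 = 1;
  ring_rep_s1 : s 1 = 1;
  ring_rep_mul : forall a b c d, b != 0 -> d != 0 ->
    u a * s b * u c * s d = u (a + b * c) * s (b * d);
  ring_rep_sum : forall b, b != 0 ->
    \sum_(c \in cosets b)
      (u (xget 0 c) * s b * star (s b) * u (- xget 0 c)) = 1
}.

Record family_rep (F : set (set R)) (A : cstarAlgType K)
    (e : set R -> A) (u s : R -> A) : Prop := FamilyRep {
  family_rep_projection : forall X, generated_algebra F X ->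
    is_projection (e X);
  family_rep_unitary : forall a, is_unitary (u a);
  family_rep_isometry : forall b, b != 0 -> is_isometry (s b);
  family_rep_u0 : u 0 = 1;
  family_rep_s1 : s 1 = 1;
  family_rep_mul : forall a b c d, b != 0 -> d != 0 ->
    u a * s b * u c * s d = u (a + b * c) * s (b * d);
  family_rep_affine : forall X a b, generated_algebra F X -> b != 0 ->
    u a * s b * e X * star (s b) * star (u a) = e (affine_image a b X);
  family_rep_eT : e setT = 1;
  family_rep_eI : forall X Y, generated_algebra F X -> generated_algebra F Y ->
    e X * e Y = e (X `&` Y);
  family_rep_eU : forall X Y, generated_algebra F X -> generated_algebra F Y ->
    X `&` Y = set0 -> e (X `|` Y) = e X + e Y
}.

(* The universal C*-algebra on generators u, s subject to ring_rep; the induced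
   homomorphisms are unital, lrmorphism including preservation of 1. *)
Definition universal_ring_rep (A : cstarAlgType K) (u s : R -> A) :=
  ring_rep u s /\
  forall (B : cstarAlgType K) (u' s' : R -> B), ring_rep u' s' ->
    let induced (f : {lrmorphism A -> B}) :=
      [/\ star_preserving f, forall a, f (u a) = u' a
        & forall b, b != 0 -> f (s b) = s' b] in
    (exists f, induced f) /\ (forall f g, induced f -> induced g -> f =1 g).

Definition universal_family_rep (F : set (set R)) (A : cstarAlgType K)
    (e : set R -> A) (u s : R -> A) :=
  family_rep F e u s /\
  forall (B : cstarAlgType K) (e' : set R -> B) (u' s' : R -> B),
    family_rep F e' u' s' ->
    let induced (f : {lrmorphism A -> B}) :=
      [/\ star_preserving f, forall X, generated_algebra F X -> f (e X) = e' X,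
          forall a, f (u a) = u' a & forall b, b != 0 -> f (s b) = s' b] in
    (exists f, induced f) /\ (forall f g, induced f -> induced g -> f =1 g).

End Representations.

(* Main.v *)
(** Every set in [generated_algebra F] is periodic modulo some [b != 0], hence a
    finite union of cosets of [(b)]; conversely all such sets belong to it.  A
    family representation must therefore send [X] to the sum, over the cosets
    [a + (b)] contained in [X], of the range projections
    [u^a s_b s_b^* u^(-a)].  It remains to see that in any representation of
    [R] these sums satisfy the relations of the projections [e_X].  They do not
    depend on [b] because each range projection splits along the cosets of
    [(b * d)], and they are multiplicative because projections with sum 1 in a
    C*-algebra are orthogonal.

    Orthogonality is proved without spectral theory.  If the [q_k] sum to 1 and
    [p = q_i], the compressions [p q_k p] for [k != i] sum to 0 and satisfy
    [|p - p q_k p| <= 1], so each of them, suitably scaled, is a self-adjoint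
    [x] of the corner with [|p + x|, |p - x| <= 1].  Then also
    [|p + i x|, |p - i x| <= 1], and such an [x] vanishes since [p] is an
    extreme point of the unit ball of the corner. *)
Require Import Defs.
From mathcomp Require Import all_boot all_order all_algebra.
From mathcomp Require Import all_classical all_reals all_analysis.
From mathcomp Require Import complex ring lra.
Set Implicit Arguments.
Unset Strict Implicit.
Unset Printing Implicit Defensive.
Import Order.TTheory GRing.Theory Num.Theory.
Local Open Scope classical_set_scope.
Local Open Scope ring_scope.

(** * Orthogonality of projections in C*-algebras *)

Section CStarTheory.
Context (K : realType) (A : cstarAlgType K).
Implicit Types (x y p q : A) (c : K[i]) (r : K).

Lemma star0 : star (0 : A) = 0.
Proof. by apply: (addrI (star 0)); rewrite -starD !addr0. Qed.

Lemma starN x : star (- x) = - star x.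
Proof. by apply: (addrI (star x)); rewrite -starD !subrr star0. Qed.

Lemma star_sum (I : Type) (s : seq I) (P : pred I) (F : I -> A) :
  star (\sum_(i <- s | P i) F i) = \sum_(i <- s | P i) star (F i).
Proof. by apply: big_morph; [exact: starD | exact: star0]. Qed.

Lemma star1 : star (1 : A) = 1.
Proof. by rewrite -[LHS]mulr1 -[X in _ * X]starK -starM mulr1 starK. Qed.

Lemma cnormZ_norm1 c x : `|c| = 1 -> cnorm (c *: x) = cnorm x.
Proof.
by move=> c1; apply: (@complexI K); rewrite cnormZ c1 mul1r.
Qed.

Lemma cnormZ_ge0 r x : 0 <= r -> cnorm (real_complex K r *: x) = r * cnorm x.
Proof.
by move=> r0; apply: (@complexI K); rewrite cnormZ ger0_norm ?ler0c// rmorphM.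
Qed.

Lemma cnormN x : cnorm (- x) = cnorm x.
Proof. by rewrite -scaleN1r cnormZ_norm1// normrN1. Qed.

Lemma cnorm0 : cnorm (0 : A) = 0.
Proof. by rewrite -(scaler0 _ (real_complex K 0)) cnormZ_ge0// mul0r. Qed.

Lemma star_mul_eq0 x : star x * x = 0 -> x = 0.
Proof.
move=> xx0; apply: cnorm_eq0; apply/eqP; rewrite -sqrf_eq0 -cstar_id xx0.
by rewrite cnorm0.
Qed.

Lemma cnorm_projection_le1 p : is_projection p -> cnorm p <= 1.
Proof.
case=> ps pp; have := cstar_id p; rewrite ps pp => pE.
have [->//|p0] := eqVneq (cnorm p) 0.
by rewrite -(mulfI p0 (etrans (mulr1 _) (etrans pE (expr2 _)))).
Qed.

(** * Polynomial calculus and the unit ball in the corner of a projection *)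

Section Corner.
Variables (p x : A).
Hypotheses (p_proj : is_projection p) (px : p * x = x) (xp : x * p = x).

(* Polynomials evaluated at [x] in the corner algebra with unit [p]. *)
Definition corner_eval (P : {poly K[i]}) : A := horner_alg x P * p.

Lemma corner_evalD P Q : corner_eval (P + Q) = corner_eval P + corner_eval Q.
Proof. by rewrite /corner_eval rmorphD mulrDl. Qed.

Lemma corner_evalZ c P : corner_eval (c *: P) = c *: corner_eval P.
Proof. by rewrite /corner_eval linearZ /= mulr_algl -scalerAl. Qed.

(** Since [p * x = x = x * p], every polynomial in [x] commutes with [p]. Identities in the
    noncommutative algebra thus reduce to polynomial identities, within reach of [ring]. *)
Lemma corner_evalM P Q : corner_eval (P * Q) = corner_eval P * corner_eval Q.
Proof.
have comm : p * horner_alg x Q = horner_alg x Q * p.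
  elim/poly_ind: Q => [|Q c IH]; first by rewrite rmorph0 mul0r mulr0.
  rewrite rmorphD rmorphM /= horner_algX horner_algC mulrDr mulrDl.
  by rewrite mulrA IH -!mulrA px xp -scalerAr -scalerAl mulr1 mul1r.
rewrite /corner_eval rmorphM /= -!mulrA; congr (_ * _).
by rewrite mulrA comm -mulrA p_proj.2.
Qed.

Lemma corner_eval_lin c : corner_eval (1 + c *: 'X) = p + c *: x.
Proof.
rewrite corner_evalD corner_evalZ /corner_eval rmorph1 mul1r horner_algX.
by rewrite xp.
Qed.

Local Notation N c := (cnorm (p + c *: x)).

Let N_mid c d : N c <= 1 -> N d <= 1 -> N ((c + d) / 2) <= 1.
Proof.
move=> Nc Nd.
have -> : p + ((c + d) / 2) *: x =
    real_complex K 2^-1 *: ((p + c *: x) + (p + d *: x)).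
  rewrite fmorphV rmorph_nat -!corner_eval_lin -corner_evalD -corner_evalZ.
  congr corner_eval; rewrite -!mul_polyC [_ / _]mulrC polyCM polyCD.
  have : (2^-1)%:P * 2 = 1 :> {poly K[i]}.
    by rewrite -polyC_natr -polyCM mulVf// pnatr_eq0.
  by move=> h; ring: h.
rewrite cnormZ_ge0 ?invr_ge0//.
have := cnormD (p + c *: x) (p + d *: x); lra.
Qed.

Let N_cube c : N c <= 1 ->
  cnorm (corner_eval ((1 + c *: 'X) ^+ 3)) <= 1.
Proof.
move=> Nc; rewrite 2!exprS expr1 !corner_evalM corner_eval_lin.
apply: (le_trans (cnormM _ _)); rewrite -[leRHS]mulr1 ler_pM ?cnorm_ge0//.
by apply: (le_trans (cnormM _ _)); rewrite -[leRHS]mulr1 ler_pM ?cnorm_ge0.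
Qed.

(* [p + 3/2 x] is a convex combination of the cubes [(p + w x)^3] with
   [w] among [1, i, -i, (1 + i)/2, (1 - i)/2]: the weights 1/6, 1/12, 1/12, 1/3,
   1/3 make the second and third moments of [w] vanish and the first one 1/2. *)
Lemma cnorm_corner_three_halves :
  N 1 <= 1 -> N (- 1) <= 1 -> N 'i <= 1 -> N (- 'i) <= 1 -> N (3 / 2) <= 1.
Proof.
move=> N1 N1' Ni Ni'.
have i2 : ('i : K[i]) ^+ 2 = -1 := sqrCi _.
set z := (1 + 'i : K[i]) / 2; set z' := (1 - 'i : K[i]) / 2.
have Nz : N z <= 1 by apply: N_mid.
have Nz' : N z' <= 1 by apply: N_mid.
have -> : p + (3 / 2) *: x = real_complex K (12^-1) *:
  ((corner_eval ((1 + 1 *: 'X) ^+ 3) + corner_eval ((1 + 1 *: 'X) ^+ 3))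
   + (corner_eval ((1 + 'i *: 'X) ^+ 3) + corner_eval ((1 + (- 'i) *: 'X) ^+ 3))
   + real_complex K 4 *: (corner_eval ((1 + z *: 'X) ^+ 3)
                         + corner_eval ((1 + z' *: 'X) ^+ 3))).
  rewrite fmorphV !rmorph_nat -!corner_eval_lin -!(corner_evalD, corner_evalZ).
  congr corner_eval.
  apply: (scalerI (a := 12)); first by rewrite pnatr_eq0.
  rewrite !scalerA mulfV ?pnatr_eq0// scale1r /z /z'.
  rewrite -!mul_polyC !(polyCM, polyCD, polyCN, polyC_natr) polyC1.
  have h : (2^-1)%:P * 2 = 1 :> {poly K[i]}.
    by rewrite -polyC_natr -polyCM mulVf// pnatr_eq0.
  have i2' : ('i%:P : {poly K[i]}) ^+ 2 = -1.
    by rewrite -polyC_exp i2 polyCN polyC1.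
  (* With half of ['X] as the variable all denominators vanish, and the square of ['i] is the only
     relation left. *)
  have X2 : 'X = 2 * ((2^-1)%:P * 'X) :> {poly K[i]}.
    by rewrite mulrA [2 * _]mulrC h mul1r.
  rewrite -!mulrA; move: X2 i2'; set Y := _ * 'X; move: Y 'i%:P => Y b -> b2.
  ring: b2.
rewrite cnormZ_ge0 ?invr_ge0//.
have := N_cube N1; have := N_cube Ni; have := N_cube Ni'.
have := N_cube Nz; have := N_cube Nz'.
set a := corner_eval _; set b := corner_eval _; set d := corner_eval _.
set e := corner_eval _; set f := corner_eval _ => le_a le_b le_d le_e le_f.
have := cnormD (f + f + (e + d)) (real_complex K 4 *: (b + a)).
rewrite cnormZ_ge0//; have := cnormD b a; have := cnormD (f + f) (e + d).
have := cnormD f f; have := cnormD e d; lra.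
Qed.

End Corner.

Definition in_corner p x := p * x = x /\ x * p = x.

Lemma in_cornerZ p c x : in_corner p x -> in_corner p (c *: x).
Proof. by case=> px xp; split; rewrite -?scalerAr -?scalerAl ?px ?xp. Qed.

(* The unit is an extreme point of the unit ball: the hypothesis is stable
   under multiplication of [x] by 3/2, hence [x] is 0. *)
Lemma corner_unit_extreme p x : is_projection p -> in_corner p x ->
  (forall c, c ^+ 4 = 1 -> cnorm (p + c *: x) <= 1) -> x = 0.
Proof.
move=> p_proj x_in x_le.
pose y n := real_complex K ((3 / 2) ^+ n) *: x.
(* All fourth roots of unity are carried along: the step for [c] uses the bound at [c], [- c] and
   [c] times ['i] or [- 'i]. *)
have y_le n c : c ^+ 4 = 1 -> cnorm (p + c *: y n) <= 1.
  elim: n c => [|n IH] c c4.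
    by rewrite /y expr0 scale1r; exact: x_le.
  have [py yp] : in_corner p (c *: y n) by do 2 apply: in_cornerZ.
  have -> : c *: y n.+1 = (3 / 2) *: (c *: y n).
    rewrite /y exprS rmorphM /= fmorph_div !rmorph_nat !scalerA.
    by congr (_ *: _); ring.
  have i4 : ('i : K[i]) ^+ 4 = 1.
    by rewrite (exprM 'i 2 2) sqrCi expr2 mulrNN mulr1.
  apply: cnorm_corner_three_halves => //; rewrite scalerA IH// exprMn c4 mulr1.
  - by rewrite expr1n.
  - by rewrite -signr_odd.
  - by [].
  - by rewrite exprNn i4 -signr_odd mulr1.
have y_le2 n : (3 / 2) ^+ n * cnorm x <= 2.
  rewrite -cnormZ_ge0 ?exprn_ge0 ?divr_ge0// -/(y n).
  have := cnormD (p + y n) (- p); rewrite [p + _]addrC addrK cnormN addrC.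
  have := y_le n 1 (expr1n _ _); rewrite scale1r.
  have := cnorm_projection_le1 p_proj; lra.
have bernoulli n : 1 + n%:R / 2 <= (3 / 2) ^+ n :> K.
  elim: n => [|n IH]; first by rewrite mul0r addr0 expr0.
  rewrite exprS -natr1; have : 0 <= n%:R :> K by []; lra.
apply: cnorm_eq0; apply/eqP/negPn/negP => x0.
have {x0} x_gt0 : 0 < cnorm x by rewrite lt0r x0 cnorm_ge0.
(* For [n] above [4 / cnorm x], Bernoulli's inequality pushes [(3 / 2) ^+ n * cnorm x] beyond 2. *)
have := archi_boundP (divr_ge0 (ler0n K 4) (ltW x_gt0)).
set n := Num.bound _; rewrite ltr_pdivrMr// => n_gt.
have := y_le2 n; have := ler_wpM2r (ltW x_gt0) (bernoulli n); lra.
Qed.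

(** If [c ^+ 2 = -1], the C*-identity turns the squared norm of [p + c *: x] into that of
    [p + x * x], the mean of the squares of [p + x] and [p - x]. So the bound holds for all fourth
    roots of unity and extremality applies. *)
Lemma corner_selfadjoint_eq0 p x : is_projection p -> in_corner p x ->
  star x = x -> cnorm (p + x) <= 1 -> cnorm (p - x) <= 1 -> x = 0.
Proof.
move=> p_proj x_in xs xle xge; apply: (corner_unit_extreme p_proj x_in).
have [px xp] := x_in.
have imag c : c ^+ 2 = -1 -> Num.conj c = - c -> cnorm (p + c *: x) <= 1.
  move=> c2 cs; rewrite -(@expr_le1 _ 2)// ?cnorm_ge0// -cstar_id.
  rewrite starD starZ xs cs p_proj.1.
  have -> : (p + - c *: x) * (p + c *: x) =
      real_complex K 2^-1 *: ((p + x) * (p + x) + (p - x) * (p - x)).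
    apply: (scalerI (a := 2)); first by rewrite pnatr_eq0.
    rewrite fmorphV rmorph_nat scalerA mulfV ?pnatr_eq0// scale1r.
    rewrite -[X in (p + X) * (p + X)]scale1r -[X in (p - X) * (p - X)]scale1r.
    rewrite -scaleNr -!(corner_eval_lin xp) -!(corner_evalM p_proj px xp).
    rewrite -!(corner_evalD, corner_evalZ); congr corner_eval.
    rewrite -!mul_polyC polyC_natr !polyCN polyC1.
    have : (c%:P : {poly K[i]}) ^+ 2 = -1 by rewrite -polyC_exp c2 polyCN polyC1.
    by move: c%:P => b b2; ring: b2.
  rewrite cnormZ_ge0 ?invr_ge0//.
  have := cnormD ((p + x) * (p + x)) ((p - x) * (p - x)).
  have sq y : cnorm y <= 1 -> cnorm (y * y) <= 1.
    move=> y1; apply: (le_trans (cnormM _ _)).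
    by rewrite -[leRHS]mulr1 ler_pM ?cnorm_ge0.
  have := sq _ xle; have := sq _ xge; lra.
move=> c; rewrite (exprM c 2 2) => /eqP; rewrite sqrf_eq1 => /orP[]/eqP c2.
  move/eqP: c2; rewrite sqrf_eq1 => /orP[]/eqP->; first by rewrite scale1r.
  by rewrite scaleN1r.
apply: imag => //; have /eqP := c2; rewrite -sqrCi eqf_sqr => /orP[]/eqP->.
  exact: conjCi.
by rewrite rmorphN; congr (- _); exact: conjCi.
Qed.

(* An elementary substitute for positivity in the corner algebra [p A p]. *)
Definition corner_positive p x :=
  [/\ in_corner p x, star x = x &
    exists2 r, 0 <= r & cnorm (real_complex K r *: p - x) <= r].

Lemma corner_positiveD p x y :
  corner_positive p x -> corner_positive p y -> corner_positive p (x + y).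
Proof.
move=> [[px xp] xs [r r0 xr]] [[py yp] ys [t t0 yt]]; split.
- by split; rewrite ?mulrDr ?mulrDl ?px ?py ?xp ?yp.
- by rewrite starD xs ys.
exists (r + t); first exact: addr_ge0.
rewrite rmorphD scalerDl opprD addrACA.
by apply: (le_trans (cnormD _ _)); exact: lerD.
Qed.

Lemma corner_positive0 p : corner_positive p 0.
Proof.
split; [by split; rewrite ?mulr0 ?mul0r | exact: star0 |].
by exists 0 => //; rewrite scale0r subr0 cnorm0.
Qed.

(** As [y = - x], the two witnesses bound [r p - x] and [t p + x]. Enlarging both coefficients of
    [p] to a common [m] and dividing by it puts [p + x / m] and [p - x / m] in the unit ball. *)
Lemma corner_positive_addr_eq0 p x y : is_projection p ->
  corner_positive p x -> corner_positive p y -> x + y = 0 -> x = 0.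
Proof.
move=> p_proj [x_in xs [r r0 xr]] [_ _ [t t0 yt]] /eqP.
rewrite addrC addr_eq0 => /eqP yE; move: yt; rewrite {}yE opprK => xt.
(* The summand 1 keeps [m] invertible when [r] and [t] both vanish. *)
pose m := r + t + 1; have m0 : 0 < m by rewrite /m; lra.
have mC0 : real_complex K m != 0 by rewrite (inj_eq (@complexI K) m 0) gt_eqF.
have pZ z : 0 <= z -> cnorm (real_complex K z *: p) <= z.
  by move=> z0; rewrite cnormZ_ge0// ler_piMr// cnorm_projection_le1.
have scaled z : cnorm (real_complex K m *: p + z) <= m ->
    cnorm (p + real_complex K m^-1 *: z) <= 1.
  have -> : p + real_complex K m^-1 *: z =
      real_complex K m^-1 *: (real_complex K m *: p + z).
    by rewrite scalerDr scalerA fmorphV mulVf// scale1r.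
  by rewrite cnormZ_ge0 ?invr_ge0 ?(ltW m0)// ler_pdivrMl// mulr1.
have : real_complex K m^-1 *: x = 0.
  apply: (corner_selfadjoint_eq0 p_proj); first exact: in_cornerZ.
  - by rewrite starZ xs; congr (_ *: _); exact: conjc_real.
  - apply: scaled.
    have -> : real_complex K m *: p + x =
        (real_complex K t *: p + x) + real_complex K (r + 1) *: p.
      by rewrite addrAC -scalerDl -rmorphD; congr (real_complex K _ *: _ + _);
        rewrite /m; ring.
    have := pZ (r + 1); have := cnormD (real_complex K t *: p + x)
      (real_complex K (r + 1) *: p); rewrite /m; lra.
  - rewrite -scalerN; apply: scaled.
    have -> : real_complex K m *: p - x =
        (real_complex K r *: p - x) + real_complex K (t + 1) *: p.
      by rewrite addrAC -scalerDl -rmorphD; congr (real_complex K _ *: _ + _);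
        rewrite /m; ring.
    have := pZ (t + 1); have := cnormD (real_complex K r *: p - x)
      (real_complex K (t + 1) *: p); rewrite /m; lra.
by move/eqP; rewrite scaler_eq0 fmorphV invr_eq0 (negPf mC0) => /eqP.
Qed.

(** The radius 1 works because [p - p * q * p] is [p * (1 - q) * p], a product of projections. *)
Lemma corner_positive_compress p q :
  is_projection p -> is_projection q -> corner_positive p (p * q * p).
Proof.
move=> p_proj q_proj; have [[ps pp] [qs qq]] := (p_proj, q_proj); split.
- by split; rewrite ?mulrA ?pp// -mulrA pp.
- by rewrite !starM ps qs mulrA.
exists 1 => //; rewrite rmorph1 scale1r.
have -> : p - p * q * p = p * (1 - q) * p.
  by rewrite mulrBr mulr1 mulrBl pp.
have q'_proj : is_projection (1 - q).
  split; first by rewrite starD star1 starN qs.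
  by rewrite mulrBl mul1r mulrBr mulr1 qq subrr subr0.
have [p1 q1] := (cnorm_projection_le1 p_proj, cnorm_projection_le1 q'_proj).
apply: (le_trans (cnormM _ _)); rewrite -[leRHS]mulr1 ler_pM ?cnorm_ge0//.
apply: (le_trans (cnormM _ _)); rewrite -[leRHS]mulr1 ler_pM ?cnorm_ge0//.
Qed.

Lemma projections_orthogonal (I : eqType) (s : seq I) (q : I -> A) :
  uniq s -> (forall i, i \in s -> is_projection (q i)) ->
  \sum_(i <- s) q i = 1 ->
  forall i j, i \in s -> j \in s -> i != j -> q i * q j = 0.
Proof.
move=> s_uniq q_proj q_sum i j is_ js ij.
have [qis qii] := q_proj i is_; have [qjs qjj] := q_proj j js.
(* Compressing the sum 1 by [q i] gives [q i], which the term [k = i] already exhausts. *)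
have : \sum_(k <- s | k != i) q i * q k * q i = 0.
  apply: (addrI (q i)); rewrite addr0.
  have qiii : q i * q i * q i = q i by rewrite !qii.
  rewrite -{1}qiii -(bigD1_seq i (F := fun k => q i * q k * q i)) //=.
  by rewrite -mulr_suml -mulr_sumr q_sum mulr1.
have js' : j != i by rewrite eq_sym.
rewrite -big_filter (bigD1_seq j) ?filter_uniq ?mem_filter ?js' //= => sum0.
have ji0 : q i * q j * q i = 0.
  apply: (corner_positive_addr_eq0 (p := q i)) sum0; first exact: q_proj.
    by apply: corner_positive_compress; exact: q_proj.
  rewrite big_seq_cond; apply: big_ind => [||k].
  - exact: corner_positive0.
  - exact: corner_positiveD.
  - rewrite mem_filter => /andP[/andP[_ ks] _].
    by apply: corner_positive_compress; exact: q_proj.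
(* The vanishing compression is [star (q j * q i) * (q j * q i)]. *)
have {ji0} : q j * q i = 0.
  by apply: star_mul_eq0; rewrite starM qis qjs mulrA -[_ * q j * q j]mulrA qjj.
by move=> /(congr1 star); rewrite starM qis qjs star0.
Qed.

End CStarTheory.

(** * Periodic sets *)

Section Cosets.
Context (R : idomainType).
Implicit Types (a b x : R) (X Y c : set R).

Definition periodic b X := forall x r, X x -> X (x + b * r).

Definition subcosets b X := cosets b `&` [set c | c `<=` X].

Lemma mem_coset a b : coset a b a.
Proof. by exists 0 => //; rewrite mulr0 addr0. Qed.

Lemma cosets_coset a b : cosets b (coset a b).
Proof. by exists a. Qed.

Lemma coset_eq a b x : coset a b x -> coset x b = coset a b.
Proof.
move=> [r _ <-]; apply/seteqP; split=> y [t _ <-].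
  by exists (r + t) => //; rewrite mulrDr addrA.
by exists (t - r) => //; ring.
Qed.

Lemma cosets_eq b c x : cosets b c -> c x -> c = coset x b.
Proof. by move=> [a _ <-] /coset_eq ->. Qed.

Lemma cosets_xget b c : cosets b c -> c = coset (xget 0 c) b.
Proof.
move=> bc; apply: cosets_eq => //.
by case: bc => a _ <-; apply: xgetPex; exists a; exact: mem_coset.
Qed.

Lemma periodic_coset a b : periodic b (coset a b).
Proof. by move=> _ r [t _ <-]; exists (t + r) => //; rewrite mulrDr addrA. Qed.

Lemma periodic_cosets b c : cosets b c -> periodic b c.
Proof. by move=> [a _ <-]; exact: periodic_coset. Qed.

Lemma periodicT b : periodic b setT.
Proof. by []. Qed.

Lemma periodic0 b : periodic b set0.
Proof. by []. Qed.

Lemma periodicU b X Y : periodic b X -> periodic b Y -> periodic b (X `|` Y).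
Proof. by move=> pX pY x r [/pX|/pY] h; [left|right]. Qed.

Lemma periodicI b X Y : periodic b X -> periodic b Y -> periodic b (X `&` Y).
Proof. by move=> pX pY x r [/pX hX /pY hY]; split. Qed.

Lemma periodicC b X : periodic b X -> periodic b (~` X).
Proof.
by move=> pX x r nX /(pX _ (- r)); rewrite mulrN addrK.
Qed.

Lemma periodicMr b d X : periodic b X -> periodic (b * d) X.
Proof. by move=> pX x r Xx; rewrite -mulrA; exact: pX. Qed.

Lemma periodic_affine a d b X :
  periodic b X -> periodic (d * b) (affine_image a d X).
Proof.
move=> pX _ r [x Xx <-]; exists (x + b * r); first exact: pX.
by rewrite mulrDr mulrA addrA.
Qed.

Lemma periodic_ideal b (I : set R) : is_ideal I -> I b -> periodic b I.
Proof. by case=> _ ID IM Ib x r Ix; apply: ID => //; rewrite mulrC; exact: IM. Qed.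

Lemma periodic_coset_sub b X x : periodic b X -> X x -> coset x b `<=` X.
Proof. by move=> pX Xx _ [r _ <-]; exact: pX. Qed.

Lemma subcosets_coset b X x : periodic b X -> X x -> subcosets b X (coset x b).
Proof.
by move=> pX Xx; split; [exact: cosets_coset | exact: periodic_coset_sub].
Qed.

Lemma bigcup_subcosets b X :
  periodic b X -> \bigcup_(c in subcosets b X) c = X.
Proof.
move=> pX; apply/seteqP; split=> [x [c [_ cX] /cX]//|x Xx].
by exists (coset x b); [exact: subcosets_coset | exact: mem_coset].
Qed.

Lemma subcosetsT b : subcosets b setT = cosets b.
Proof. by rewrite /subcosets; apply/seteqP; split=> [c []|c bc]//; split. Qed.

Lemma subcosets0 b : subcosets b set0 = set0.
Proof.
apply/seteqP; split=> // c [[a _ <-] /(_ a (mem_coset a b))]; exact.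
Qed.

Lemma subcosetsI b X Y :
  subcosets b (X `&` Y) = subcosets b X `&` subcosets b Y.
Proof.
apply/seteqP; split=> c.
  by move=> [bc cXY]; split; split=> // x /cXY[].
by move=> [[bc cX] [_ cY]]; split=> // x cx; split; [exact: cX | exact: cY].
Qed.

Lemma subcosetsU b X Y : periodic b X -> periodic b Y ->
  subcosets b (X `|` Y) = subcosets b X `|` subcosets b Y.
Proof.
move=> pX pY; apply/seteqP; split=> c.
  move=> [[a _ <-] /(_ a (mem_coset a b))] [h|h]; [left|right];
    exact: subcosets_coset.
by move=> [[bc cX]|[bc cY]]; split=> // x h; [left; exact: cX|right; exact: cY].
Qed.

Lemma subcosets_cosets b c : cosets b c -> subcosets b c = [set c].
Proof.
move=> bc; apply/seteqP; split=> [_ [[a _ <-]] /(_ a (mem_coset a b)) ca|_ ->].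
  by rewrite -(cosets_eq bc ca).
by split=> // x.
Qed.

Lemma finite_subcosets b X : finite_set (cosets b) -> finite_set (subcosets b X).
Proof. by move=> fin; exact: finite_setIl. Qed.

(** A periodic set is the union of its finitely many subcosets, listed without repetition and added
    one at a time; distinct cosets are disjoint. *)
Lemma periodic_ind b (Q : set R -> Prop) : finite_set (cosets b) -> Q set0 ->
  (forall c X, cosets b c -> periodic b X -> c `&` X = set0 ->
    Q X -> Q (c `|` X)) ->
  forall X, periodic b X -> Q X.
Proof.
move=> fin Q0 QU X pX; rewrite -(bigcup_subcosets pX).
have /finite_seqP[t tE] := finite_subcosets X fin.
have : forall c, c \in undup t -> cosets b c.
  by move=> c ct; have [] : subcosets b X c by rewrite tE /= -mem_undup.
have -> : subcosets b X = [set` undup t].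
  by rewrite tE; apply/seteqP; split=> c /=; rewrite mem_undup.
move: (undup t) (undup_uniq t) => s s_uniq s_cosets.
suff [] : Q (\bigcup_(c in [set` s]) c) /\ periodic b (\bigcup_(c in [set` s]) c).
  by [].
elim: s s_uniq s_cosets => [|c s IH] /=.
  by rewrite set_nil ?bigcup_set0; split=> //; exact: periodic0.
move=> /andP[c_s s_uniq] s_cosets.
have bc : cosets b c by apply: s_cosets; rewrite mem_head.
have s_cosets' : forall d, d \in s -> cosets b d.
  by move=> d ds; apply: s_cosets; rewrite inE ds orbT.
have [Qs ps] := IH s_uniq s_cosets'.
have -> : [set` c :: s] = c |` [set` s].
  by apply/seteqP; split=> d /=; rewrite inE => /predU1P.
rewrite bigcup_setU1; split; last first.
  by apply: periodicU => //; exact: periodic_cosets.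
apply: QU => //; apply/seteqP; split=> // x [cx [d ds dx]].
move: c_s; rewrite (cosets_eq bc cx) -(cosets_eq (s_cosets' _ ds) dx).
by rewrite (ds : is_true (d \in s)).
Qed.

(** Induction over disjoint unions of cosets; additivity on two empty sets forces [G set0 = 0]. It
    serves both for the projections of a family representation and for changing the modulus. *)
Lemma additive_subcosets (V : zmodType) (G : set R -> V) b X :
  finite_set (cosets b) ->
  (forall X Y, periodic b X -> periodic b Y -> X `&` Y = set0 ->
    G (X `|` Y) = G X + G Y) ->
  periodic b X -> G X = \sum_(c \in subcosets b X) G c.
Proof.
move=> fin GU; move: X; apply: periodic_ind => // [|c X bc pX cX IH].
  rewrite subcosets0 fsbig_set0; apply: (addrI (G set0)).
  by rewrite -GU ?setI0// setU0 addr0.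
have pc := periodic_cosets bc.
rewrite subcosetsU// subcosets_cosets// fsbigU0 ?fsbig_set1 ?GU ?IH//.
  exact: finite_subcosets.
move=> _ [-> [_ c_sub]]; have c0 := mem_coset (xget 0 c) b.
rewrite -(cosets_xget bc) in c0.
have : (c `&` X) (xget 0 c) by split=> //; exact: c_sub.
by rewrite cX.
Qed.

Lemma affine_image_inj a d x y : d != 0 -> a + d * x = a + d * y -> x = y.
Proof. by move=> d0 /addrI /(mulfI d0). Qed.

Lemma affine_coset a d x b :
  affine_image a d (coset x b) = coset (a + d * x) (d * b).
Proof.
apply/seteqP; split=> [_ [_ [r _ <-] <-]|_ [r _ <-]].
  by exists r => //; rewrite mulrDr mulrA addrA.
by exists (x + b * r); [exists r | rewrite mulrDr mulrA addrA].
Qed.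

Lemma affine_subcosets_bij a d b X : d != 0 ->
  set_bij (subcosets b X) (subcosets (d * b) (affine_image a d X))
    (affine_image a d).
Proof.
move=> d0; split.
- move=> _ [[x _ <-] xX]; split; first by rewrite affine_coset; exists (a + d * x).
  by move=> _ [y /xX Xy <-]; exists y.
- move=> c c' _ _ cc'; suff sub (Y Z : set R) :
      affine_image a d Y = affine_image a d Z -> Y `<=` Z.
    by apply/seteqP; split; exact: sub.
  move=> YZ y Yy; have : affine_image a d Z (a + d * y) by rewrite -YZ; exists y.
  by move=> [z Zz /(affine_image_inj d0) <-].
- move=> _ [[y _ <-] yX]; have [x Xx xy] := yX _ (mem_coset _ _).
  exists (coset x b); last by rewrite affine_coset xy.
  split; first exact: cosets_coset.
  move=> z xz; have : affine_image a d X (a + d * z).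
    by apply: yX; rewrite -xy -affine_coset; exists z.
  by move=> [t Xt /(affine_image_inj d0) <-].
Qed.

(** * The generated algebra consists of periodic sets *)

Lemma generated_algebra_invariant (F : set (set R)) :
  invariant_algebra (generated_algebra F).
Proof.
split=> [C [[]]//|X Y hX hY C FC|X Y hX hY C FC|X hX C FC|X a b hX b0 C FC].
- by have [[_ CU _ _ _] _] := FC; apply: CU; [exact: hX | exact: hY].
- by have [[_ _ CI _ _] _] := FC; apply: CI; [exact: hX | exact: hY].
- by have [[_ _ _ CC _] _] := FC; apply: CC; exact: hX.
- by have [[_ _ _ _ CA] _] := FC; apply: CA => //; exact: hX.
Qed.

(** Sets with a nonzero period form an invariant algebra, the product of two periods being a common
    one. An ideal is periodic modulo each of its elements. *)
Lemma generated_algebra_periodic (F : set (set R)) X :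
  (forall I, F I -> is_nonzero_ideal I) -> generated_algebra F X ->
  exists2 b, b != 0 & periodic b X.
Proof.
move=> F_ideal gX.
apply: (gX [set Y | exists2 b, b != 0 & periodic b Y]); split; last first.
  move=> I /F_ideal[I_ideal I0].
  have [b Ib b0] : exists2 b, I b & b != 0.
    apply: contrapT => nI; move/eqP: I0; apply; apply/seteqP; split=> [b Ib|_ ->].
      by apply/eqP/negPn/negP => b0; apply: nI; exists b.
    by case: I_ideal.
  by exists b => //; exact: periodic_ideal.
split.
- by exists 1; [exact: oner_neq0 | exact: periodicT].
- move=> Y Z [b b0 pY] [d d0 pZ]; exists (b * d); first exact: mulf_neq0.
  by apply: periodicU; [|rewrite mulrC]; exact: periodicMr.
- move=> Y Z [b b0 pY] [d d0 pZ]; exists (b * d); first exact: mulf_neq0.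
  by apply: periodicI; [|rewrite mulrC]; exact: periodicMr.
- by move=> Y [b b0 pY]; exists b => //; exact: periodicC.
- move=> Y a d [b b0 pY] d0; exists (d * b); first exact: mulf_neq0.
  exact: periodic_affine.
Qed.

(** A coset of [(b)] is an affine image of the whole ring, so it lies in every invariant algebra, as
    do finite unions of such cosets. *)
Lemma periodic_generated_algebra (F : set (set R)) b X :
  b != 0 -> finite_set (cosets b) -> periodic b X -> generated_algebra F X.
Proof.
move=> b0 fin; have [CT CU _ CC CA] := generated_algebra_invariant F.
move: X; apply: periodic_ind => // [|_ X [a _ <-] _ _ CX].
  by rewrite -setCT; exact: CC.
by apply: CU => //; exact: CA.
Qed.

End Cosets.

(** * Projections attached to periodic sets *)

Definition coset_projection (K : realType) (A : cstarAlgType K)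
    (R : idomainType) (u s : R -> A) (b : R) (c : set R) : A :=
  u (xget 0 c) * s b * star (s b) * u (- xget 0 c).

Definition periodic_projection (K : realType) (A : cstarAlgType K)
    (R : idomainType) (u s : R -> A) (b : R) (X : set R) : A :=
  \sum_(c \in subcosets b X) coset_projection u s b c.

(** * Range projections of cosets, from relations common to both kinds of representation *)

Section Translations.
Context (K : realType) (A : cstarAlgType K) (R : idomainType) (u s : R -> A).
Hypotheses (u_unitary : forall a, Defs.is_unitary (u a)) (u0 : u 0 = 1) (s1 : s 1 = 1).
Hypothesis us_mul : forall a b c d, b != 0 -> d != 0 ->
  u a * s b * u c * s d = u (a + b * c) * s (b * d).

Lemma star_translation a : star (u a) = u (- a).
Proof.
have := us_mul a (- a) (oner_neq0 R) (oner_neq0 R).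
rewrite !mul1r s1 !mulr1 subrr u0 => uu.
by rewrite -[LHS]mulr1 -uu mulrA (u_unitary a).1 mul1r.
Qed.

Lemma coset_projection_xget b c : coset_projection u s b c =
  u (xget 0 c) * s b * star (u (xget 0 c) * s b).
Proof. by rewrite starM star_translation !mulrA. Qed.

(** Another representative [a + b * r] changes [u a * s b] by the right factor [u r], a unitary that
    cancels against its adjoint. *)
Lemma coset_projection_coset a b : b != 0 ->
  coset_projection u s b (coset a b) = u a * s b * star (u a * s b).
Proof.
move=> b0; rewrite coset_projection_xget.
have [r _ <-] : coset a b (xget 0 (coset a b)).
  by apply: xgetPex; exists a; exact: mem_coset.
have -> : u (a + b * r) * s b = u a * s b * u r.
  by have := us_mul a r b0 (oner_neq0 R); rewrite s1 !mulr1.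
rewrite (starM _ (u r)) mulrA -[_ * u r * _]mulrA.
by have [_ ->] := u_unitary r; rewrite mulr1.
Qed.

End Translations.

(** * From a ring representation to a family representation *)

Section RingRepresentation.
Context (K : realType) (A : cstarAlgType K) (R : idomainType) (u s : R -> A).
Hypotheses (fin : finite_quotients R) (rep : ring_rep u s).
Implicit Types (a b d x : R) (X Y c : set R).

Local Notation P := (coset_projection u s).
Local Notation E := (periodic_projection u s).

Let PE b c := coset_projection_xget (ring_rep_unitary rep)
  (ring_rep_u0 rep) (ring_rep_s1 rep) (ring_rep_mul rep) b c.

Let P_coset a b := coset_projection_coset (ring_rep_unitary rep)
  (ring_rep_u0 rep) (ring_rep_s1 rep) (ring_rep_mul rep) a (b := b).

Lemma coset_projectionP b c : b != 0 -> is_projection (P b c).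
Proof.
move=> b0; rewrite PE; split; first by rewrite starM starK.
rewrite -mulrA [X in _ * X]mulrA; set a := xget 0 c.
have -> : star (u a * s b) * (u a * s b) = 1.
  rewrite starM -mulrA [star (u a) * _]mulrA (ring_rep_unitary rep a).1 mul1r.
  exact: (ring_rep_isometry rep).
by rewrite mul1r.
Qed.

Lemma periodic_projectionT b : b != 0 -> E b setT = 1.
Proof.
by move=> b0; rewrite /periodic_projection subcosetsT; exact: ring_rep_sum.
Qed.

Lemma coset_projection_orthogonal b c c' : b != 0 ->
  cosets b c -> cosets b c' -> c != c' -> P b c * P b c' = 0.
Proof.
move=> b0 bc bc'.
apply: (@projections_orthogonal _ _ _ (finmap.enum_fset (fset_set (cosets b))) (P b)).
- exact: finmap.fset_uniq.
- by move=> i _; exact: coset_projectionP.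
- by rewrite -fsbig_finite ?(ring_rep_sum rep)//; exact: fin.
- by rewrite in_fset_set ?inE//; exact: fin.
- by rewrite in_fset_set ?inE//; exact: fin.
Qed.

Lemma periodic_projectionU b X Y : b != 0 -> periodic b X -> periodic b Y ->
  X `&` Y = set0 -> E b (X `|` Y) = E b X + E b Y.
Proof.
move=> b0 pX pY XY; rewrite /periodic_projection subcosetsU// fsbigU0//.
- by apply: finite_subcosets; exact: fin.
- by apply: finite_subcosets; exact: fin.
- by rewrite -subcosetsI XY subcosets0.
Qed.

Lemma periodic_projectionI b X Y : b != 0 ->
  E b X * E b Y = E b (X `&` Y).
Proof.
move=> b0; have finb X' : finite_set (subcosets b X').
  by apply: finite_subcosets; exact: fin.
(* By orthogonality, multiplying by [E b Y] keeps the projections of cosets inside [Y] and kills the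
   others. *)
have mulE c : c \in subcosets b X ->
    P b c * E b Y = if c \in subcosets b Y then P b c else 0.
  rewrite inE => -[bc _]; rewrite fsbig_distrr//; case: ifPn => [|nYc].
    rewrite inE => Yc; rewrite (fsbigD1 c)//= (coset_projectionP c b0).2.
    rewrite fsbig1 ?addr0// => d [[bd _] dc].
    by apply: coset_projection_orthogonal => //; apply/eqP => cd; exact: dc.
  rewrite fsbig1// => d Yd; apply: coset_projection_orthogonal => //.
    by case: Yd.
  by apply: contraNneq nYc => ->; rewrite inE.
rewrite [RHS]/periodic_projection subcosetsI fsbig_mkcondr.
transitivity (\sum_(c \in subcosets b X) P b c * E b Y); last exact: eq_fsbigr.
by rewrite [X in X * _](fsbig_finite _ _ (finb X)) mulr_suml fsbig_finite.
Qed.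

Lemma star_periodic_projection b X : b != 0 -> star (E b X) = E b X.
Proof.
move=> b0; rewrite star_sum; apply: eq_bigr => c _.
exact: (coset_projectionP c b0).1.
Qed.

(** The affine map sends the cosets of [(b)] in [X] bijectively to those of [(d * b)] in the image,
    and the multiplication relation matches the summands. *)
Lemma periodic_projection_affine a d b X : d != 0 -> b != 0 ->
  u a * s d * E b X * star (s d) * star (u a) =
  E (d * b) (affine_image a d X).
Proof.
move=> d0 b0; have db0 : d * b != 0 by exact: mulf_neq0.
have finb : finite_set (subcosets b X).
  by apply: finite_subcosets; exact: fin.
rewrite /periodic_projection.
rewrite [RHS](reindex_fsbig _ _ _ _ (affine_subcosets_bij a b X d0)).
rewrite !fsbig_finite// mulr_sumr !mulr_suml.
rewrite big_seq [RHS]big_seq; apply: eq_bigr => c.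
rewrite in_fset_set// inE => -[[x _ <-] _].
rewrite affine_coset !P_coset// -(ring_rep_mul rep)//.
by rewrite !(starM, mulrA).
Qed.

(** The affine relation for the whole ring, whose projection at modulus [d] is 1. *)
Lemma coset_projection_refine a b d : b != 0 -> d != 0 ->
  P b (coset a b) = E (b * d) (coset a b).
Proof.
move=> b0 d0; rewrite -periodic_projection_affine// periodic_projectionT//.
by rewrite mulr1 P_coset// starM !mulrA.
Qed.

Lemma periodic_projection_refine b d X : b != 0 -> d != 0 -> periodic b X ->
  E b X = E (b * d) X.
Proof.
move=> b0 d0 pX; have bd0 : b * d != 0 by exact: mulf_neq0.
rewrite [RHS](@additive_subcosets _ _ (E (b * d)) b)//; first last.
- by move=> Y Z pY pZ; apply: periodic_projectionU => //; exact: periodicMr.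
- exact: fin.
apply: eq_fsbigr => c; rewrite inE => -[[a _ <-] _].
exact: coset_projection_refine.
Qed.

Lemma periodic_projection_indep b d X : b != 0 -> d != 0 ->
  periodic b X -> periodic d X -> E b X = E d X.
Proof.
move=> b0 d0 pb pd; rewrite (periodic_projection_refine b0 d0 pb).
by rewrite mulrC -periodic_projection_refine.
Qed.

(** Any nonzero period gives the same value; the default modulus 1 is reached only by sets without
    one. *)
Definition set_projection X : A :=
  E (xget 1 [set b | b != 0 /\ periodic b X]) X.

Lemma set_projectionE b X : b != 0 -> periodic b X -> set_projection X = E b X.
Proof.
move=> b0 pX; rewrite /set_projection.
have [d0 pd] := @xgetPex _ 1 [set b | b != 0 /\ periodic b X]
  (ex_intro _ b (conj b0 pX)).
exact: periodic_projection_indep.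
Qed.

Lemma set_projection_family_rep (F : set (set R)) :
  (forall I, F I -> is_nonzero_ideal I) -> family_rep F set_projection u s.
Proof.
move=> F_ideal.
have common X Y : generated_algebra F X -> generated_algebra F Y ->
    exists b, [/\ b != 0, periodic b X & periodic b Y].
  move=> /(generated_algebra_periodic F_ideal)[b b0 pX].
  move=> /(generated_algebra_periodic F_ideal)[d d0 pY].
  exists (b * d); split; [exact: mulf_neq0 | exact: periodicMr |].
  by rewrite mulrC; exact: periodicMr.
split; try by case: rep.
- move=> X /(generated_algebra_periodic F_ideal)[b b0 pX].
  rewrite (set_projectionE b0 pX); split; first exact: star_periodic_projection.
  by rewrite periodic_projectionI// setIid.
- move=> X a b /(generated_algebra_periodic F_ideal)[d d0 pX] b0.
  rewrite (set_projectionE d0 pX) periodic_projection_affine//.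
  by rewrite (@set_projectionE (b * d))//; [exact: mulf_neq0|exact: periodic_affine].
- rewrite (set_projectionE (oner_neq0 R) (@periodicT R 1)).
  exact/periodic_projectionT/oner_neq0.
- move=> X Y /common h /h[b [b0 pX pY]].
  rewrite !(set_projectionE b0)// ?periodic_projectionI//.
  exact: periodicI.
- move=> X Y /common h /h[b [b0 pX pY]] XY.
  rewrite !(set_projectionE b0)// ?periodic_projectionU//.
  exact: periodicU.
Qed.

End RingRepresentation.

(** * From a family representation to a ring representation *)

Section FamilyRepresentation.
Context (K : realType) (A : cstarAlgType K) (R : idomainType) (F : set (set R)).
Context (e : set R -> A) (u s : R -> A).
Hypotheses (fin : finite_quotients R) (rep : family_rep F e u s).

(** Additivity reduces the claim to cosets, where the affine relation for the whole ring and
    [e setT = 1] dictate the value. *)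
Lemma family_rep_periodic_projection b X : b != 0 -> periodic b X ->
  e X = periodic_projection u s b X.
Proof.
move=> b0 pX; have gen Y : periodic b Y -> generated_algebra F Y.
  by apply: periodic_generated_algebra => //; exact: fin.
rewrite (additive_subcosets (G := e) (fin b0) _ pX); last first.
  by move=> Y Z pY pZ; apply: (family_rep_eU rep); exact: gen.
apply: eq_fsbigr => c; rewrite inE => -[[a _ <-] _].
rewrite (coset_projection_coset (family_rep_unitary rep) (family_rep_u0 rep)
  (family_rep_s1 rep) (family_rep_mul rep))//.
rewrite starM !mulrA -(family_rep_affine rep)//.
  by rewrite (family_rep_eT rep) mulr1.
exact: gen (@periodicT R b).
Qed.

(** The sum relation is the decomposition of [e setT = 1] into coset projections. *)
Lemma family_rep_ring_rep : ring_rep u s.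
Proof.
split; try by case: rep.
move=> b b0; rewrite -(family_rep_eT rep).
rewrite (family_rep_periodic_projection b0)//.
by rewrite /periodic_projection subcosetsT.
Qed.

End FamilyRepresentation.

(** * Comparison of the two universal algebras *)

Lemma lrmorphism_periodic_projection (K : realType) (A B : cstarAlgType K)
    (R : idomainType) (u s : R -> A) (u' s' : R -> B) (f : {lrmorphism A -> B})
    (b : R) (X : set R) :
  star_preserving f -> (forall a, f (u a) = u' a) -> f (s b) = s' b ->
  finite_set (cosets b) ->
  f (periodic_projection u s b X) = periodic_projection u' s' b X.
Proof.
move=> f_star fu fs fin; have finX := finite_subcosets X fin.
rewrite /periodic_projection !fsbig_finite// rmorph_sum.
apply: eq_bigr => c _.
by rewrite /coset_projection !rmorphM /= f_star fs !fu.
Qed.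

Theorem lemma3p8 (K : realType) (R : idomainType) (F : set (set R))
    (A : cstarAlgType K) (uA sA : R -> A)
    (B : cstarAlgType K) (eB : set R -> B) (uB sB : R -> B) :
  finite_quotients R ->
  (forall I, F I -> is_nonzero_ideal I) ->
  universal_ring_rep uA sA ->
  universal_family_rep F eB uB sB ->
  exists f : {lrmorphism A -> B},
    [/\ star_preserving f,
        forall a, f (uA a) = uB a,
        forall b, b != 0 -> f (sA b) = sB b
      & bijective f].
Proof.
move=> fin F_ideal [repA univA] [repB univB].
have [[f [f_star fu fs]] _] := univA _ _ _ (family_rep_ring_rep fin repB).
have repA' := set_projection_family_rep fin repA F_ideal.
have [[g [g_star ge gu gs]] _] := univB _ _ _ _ repA'.
exists f; split=> //; exists g => x.
(* Both composites fix the generators, so uniqueness identifies them with the identity. *)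
- have [_ uniq] := univA _ _ _ repA.
  apply: (uniq (g \o f : {lrmorphism A -> A}) (idfun : {lrmorphism A -> A})).
    split=> [y|a|b b0] /=; first by rewrite f_star g_star.
      by rewrite fu gu.
    by rewrite fs// gs.
  by split.
- have [_ uniq] := univB _ _ _ _ repB.
  apply: (uniq (f \o g : {lrmorphism B -> B}) (idfun : {lrmorphism B -> B})).
    split=> [y|X FX|a|b b0] /=.
    + by rewrite g_star f_star.
    (* Here [g] sends [eB X] to a sum of coset projections in [A]; [f] carries it to the same sum in
       [B], which is [eB X]. *)
    + have [b b0 pX] := generated_algebra_periodic F_ideal FX.
      rewrite ge// (set_projectionE fin repA b0 pX).
      rewrite (family_rep_periodic_projection fin repB b0 pX).
      by apply: lrmorphism_periodic_projection => //; [exact: fs | exact: fin].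
    + by rewrite gu fu.
    + by rewrite gs// fs.
  by split.
Qed.
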